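(* Let $E$ be a holomorphic vector bundle of rank $l$ over a domain $\Omega\subseteq\mathbb{C}$, let $n$ be a positive integer, and let $E^n$ be the $n$-jet bundle of $E$. Let $P$ be the constant $(n+1)\times(n+1)$ block matrix with $l\times l$ blocks, rows and columns indexed by $0,1,\dots,n$, whose $(k,k-1)$ block is $kI$ for $1\le k\le n$ ($I$ being the $l\times l$ identity matrix) and all of whose other blocks are $0$. Then $P$ represents a well-defined bundle map on $E^n$ (called the Pascal map). That is, there is a unique bundle map $E^n\to E^n$, mapping each fiber linearly to itself, which is represented by the matrix $P$ with respect to the induced local frame $\{\mathbf{s},\mathbf{s}',\dots,\mathbf{s}^{(n)}\}$ of $E^n$ for every local holomorphic frame $\mathbf{s}=\{s_1,\dots,s_l\}$ of $E$; explicitly, it acts by $s_i\mapsto 0$ and $s_i^{(k)}\mapsto k\,s_i^{(k-1)}$ for $1\le i\le l$, $1\le k\le n$.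
   Context: Conventions: a local frame $\mathbf{s}=\{s_1,\dots,s_l\}$ is regarded as a column vector, matrices act on it from the left, and a linear map is represented by a matrix $M$ with respect to a frame (column) $\mathbf{S}$ if it sends the entries of $\mathbf{S}$ to the corresponding entries of $M\mathbf{S}$. For an invertible holomorphic $l\times l$ matrix function $A$ on an open subset of $\mathbb{C}$, let $\Lambda^n_A$ denote the $(n+1)\times(n+1)$ block lower triangular matrix function whose $(p,q)$ block ($0\le p,q\le n$) is $\binom{p}{q}A^{(p-q)}$ if $q\le p$ and $0$ if $q>p$, where $A^{(k)}$ is the $k$-th derivative of $A$ with respect to the coordinate $z$ of $\mathbb{C}$. The $n$-jet bundle $E^n$: each local holomorphic frame $\mathbf{s}$ of $E$ over an open set $U\subseteq\Omega$ induces a local holomorphic frame of $E^n$ over $U$, denoted $\{\mathbf{s},\mathbf{s}',\dots,\mathbf{s}^{(n)}\}$ and consisting of $(n+1)l$ sections $s_i^{(k)}$, $1\le i\le l$, $0\le k\le n$. If $\mathbf{s}$ and $\mathbf{t}$ are two local holomorphic frames with $\mathbf{s}=A\mathbf{t}$ on the overlap of their domains, where $A$ is an invertible holomorphic matrix function, then the induced frames are related by $(\mathbf{s},\mathbf{s}',\dots,\mathbf{s}^{(n)})^T=\Lambda^n_A\,(\mathbf{t},\mathbf{t}',\dots,\mathbf{t}^{(n)})^T$. In other words, if $E$ has local trivializations $\{U_\alpha\}$ with transition functions $\{A_{\alpha\beta}\}$, then $E^n$ is the vector bundle with transition functions $\{\Lambda^n_{A_{\alpha\beta}}\}$, which satisfy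 the cocycle condition. Concrete model: if $f:\Omega\to Gr(l,\mathcal{H})$ is a holomorphic map into the Grassmannian of $l$-dimensional subspaces of a complex vector space $\mathcal{H}$ (locally $f(z)$ is the span of holomorphic $\mathcal{H}$-valued functions $s_1(z),\dots,s_l(z)$) and $E=\{(h,z)\in\mathcal{H}\times\Omega: h\in f(z)\}$, then $E^n(z)$ is the span in $\mathcal{H}$ of $s_i^{(k)}(z)$, $1\le i\le l$, $0\le k\le n$, where $s_i^{(k)}$ is the actual $k$-th derivative. These vectors are assumed linearly independent at every $z\in\Omega$, so that they form the induced frame. *)

(* Defs.v *)
From HB Require Import structures.
From mathcomp Require Import all_boot all_order all_algebra.
From mathcomp Require Import complex.
From mathcomp Require Import all_classical all_reals all_analysis.

Set Implicit Arguments.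
Unset Strict Implicit.
Unset Printing Implicit Defensive.

Import Order.TTheory GRing.Theory Num.Theory numFieldNormedType.Exports.
Local Open Scope classical_set_scope.
Local Open Scope ring_scope.

(* Packing R[i] as a numClosedFieldType gives it the topology and the
   normed-module structure that every numFieldType has over itself, so that
   [derivable f z 1] and [derive1n k f] are complex derivatives. *)
Definition Cplx (R : realType) : numClosedFieldType := R[i]%C.

Definition is_domain (R : realType) (Omega : set (Cplx R)) : Prop :=
  [/\ open Omega, connected Omega & Omega !=set0].

Definition holomorphic_mx (R : realType) (m n : nat) (W : set (Cplx R))
    (A : Cplx R -> 'M[Cplx R]_(m, n)) : Prop :=
  forall i j z, W z -> derivable (fun w => A w i j) z 1.

Definition deriv_mx (R : realType) (m n k : nat)
    (A : Cplx R -> 'M[Cplx R]_(m, n)) (z : Cplx R) : 'M[Cplx R]_(m, n) :=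
  \matrix_(i, j) derive1n k (fun w => A w i j) z.

(* The column M S, for a column S of vectors. *)
Definition mulmx_frame (K : fieldType) (V : vectType K) (m : nat)
    (M : 'M[K]_m) (S : m.-tuple V) : m.-tuple V :=
  [tuple \sum_j M i j *: tnth S j | i < m].

(* The matrix A with S = A T, when T is a basis. *)
Definition frame_mx (K : fieldType) (V : vectType K) (m : nat)
    (S T : m.-tuple V) : 'M[K]_m :=
  \matrix_(i, j) coord T j (tnth S i).

(* A trivialization of a bundle over an open set is given by the frame that it
   sends to the standard basis; transition functions are changes of frame.
   Fibers and frames are indexed by the whole plane, but only their values over
   Omega, respectively over the domain of the frame, are meaningful. *)
Record hol_vbundle (R : realType) (Omega : set (Cplx R)) (l : nat) := HolVBundle {
  fiber :> Cplx R -> vectType (Cplx R);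
  triv_index : Type;
  triv_dom : triv_index -> set (Cplx R);
  triv_frame : triv_index -> forall z, l.-tuple (fiber z);
  triv_dom_open : forall a, open (triv_dom a);
  triv_dom_sub : forall a, triv_dom a `<=` Omega;
  triv_dom_cover : forall z, Omega z -> exists a, triv_dom a z;
  triv_frame_basis :
    forall a z, triv_dom a z -> basis_of fullv (triv_frame a z);
  triv_transition_hol : forall a b,
    holomorphic_mx (triv_dom a `&` triv_dom b)
      (fun z => frame_mx (triv_frame a z) (triv_frame b z)) }.

Arguments triv_dom {R Omega l} E a : rename.
Arguments triv_frame {R Omega l} E a z : rename.

Record hol_frame (R : realType) (Omega : set (Cplx R)) (l : nat)
    (E : hol_vbundle Omega l) (U : set (Cplx R)) := HolFrame {
  frame_val :> forall z, l.-tuple (E z);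
  frame_dom_open : open U;
  frame_dom_sub : U `<=` Omega;
  frame_basis : forall z, U z -> basis_of fullv (frame_val z);
  frame_hol : forall a,
    holomorphic_mx (U `&` triv_dom E a)
      (fun z => frame_mx (frame_val z) (triv_frame E a z)) }.

Record bundle_endo (R : realType) (Omega : set (Cplx R)) (l : nat)
    (E : hol_vbundle Omega l) := BundleEndo {
  endo_val :> forall z, 'End(E z);
  endo_hol : forall a,
    holomorphic_mx (triv_dom E a)
      (fun z => frame_mx (map_tuple (endo_val z) (triv_frame E a z))
                         (triv_frame E a z)) }.

Definition represented_by (R : realType) (Omega : set (Cplx R)) (l : nat)
    (E : hol_vbundle Omega l) (U : set (Cplx R)) (Phi : forall z, 'End(E z))
    (S : forall z, l.-tuple (E z)) (M : 'M[Cplx R]_l) : Prop :=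
  forall z, U z -> map_tuple (Phi z) (S z) = mulmx_frame M (S z).

Definition jet_mx (R : realType) (l n : nat) (A : Cplx R -> 'M[Cplx R]_l)
    (z : Cplx R) : 'M[Cplx R]_(\sum_(p < n.+1) l) :=
  \mxblock_(p < n.+1, q < n.+1)
    (if (q <= p)%N then 'C(p, q)%:R *: deriv_mx (p - q) A z else 0).

Definition pascal_mx (R : realType) (l n : nat) :
    'M[Cplx R]_(\sum_(p < n.+1) l) :=
  \mxblock_(p < n.+1, q < n.+1)
    (if p == q.+1 :> nat then p%:R%:M else 0 : 'M[Cplx R]_l).

(* The jet bundle consists of a bundle and of its induced frames; the law of
   change of induced frames determines it up to a unique isomorphism that
   matches the induced frames. *)
Record jet_bundle (R : realType) (Omega : set (Cplx R)) (l : nat)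
    (E : hol_vbundle Omega l) (n : nat) := JetBundle {
  jet_total :> hol_vbundle Omega (\sum_(p < n.+1) l);
  jet_frame : forall U, hol_frame E U -> hol_frame jet_total U;
  jet_frame_change : forall U V (s : hol_frame E U) (t : hol_frame E V)
      (A : Cplx R -> 'M[Cplx R]_l),
    holomorphic_mx (U `&` V) A ->
    (forall z, (U `&` V) z -> A z \in unitmx) ->
    (forall z, (U `&` V) z -> s z = mulmx_frame (A z) (t z)) ->
    forall z, (U `&` V) z ->
      jet_frame s z = mulmx_frame (jet_mx n A z) (jet_frame t z) }.

Arguments jet_frame {R Omega l E n} En {U} s : rename.

(* The section s_i^(k) of the induced frame. *)
Definition jet_section (R : realType) (Omega : set (Cplx R)) (l : nat)
    (E : hol_vbundle Omega l) (n : nat) (En : jet_bundle E n)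
    (U : set (Cplx R)) (s : hol_frame E U) (k : 'I_n.+1) (i : 'I_l)
    (z : Cplx R) : En z :=
  tnth (jet_frame En s z) (@tagnat.Rank n.+1 (fun=> l) k i).

(* Main.v *)
Require Import Defs.
From HB Require Import structures.
From mathcomp Require Import all_boot all_order all_algebra.
From mathcomp Require Import complex.
From mathcomp Require Import all_classical all_reals all_analysis.

Set Implicit Arguments.
Unset Strict Implicit.
Unset Printing Implicit Defensive.

Import Order.TTheory GRing.Theory Num.Theory numFieldNormedType.Exports.
Local Open Scope classical_set_scope.
Local Open Scope ring_scope.

(* The Pascal matrix P commutes with every transition matrix Lambda of the jet
   bundle: up to the common factor A^(p-q-1), the (p, q) blocks of Lambda P and
   P Lambda are (q + 1) C(p, q + 1) and p C(p - 1, q), which agree.  Hence the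
   endomorphism of a fiber having matrix P in the jet frame induced by one
   trivialization has matrix P in every induced jet frame.  In a trivialization
   of E^n its matrix is B^-1 P B, with B the holomorphic change of frame. *)

(** * Linear algebra of frames and their change matrices *)

Section FrameChange.
Variables (K : fieldType) (V : vectType K) (m : nat).
Implicit Types (S T : m.-tuple V) (M N : 'M[K]_m).

Lemma mulmx_frameA M N S :
  mulmx_frame M (mulmx_frame N S) = mulmx_frame (M *m N) S.
Proof.
apply: eq_from_tnth => i; rewrite !tnth_mktuple.
under eq_bigr => j _ do rewrite tnth_mktuple scaler_sumr.
rewrite exchange_big /=; apply: eq_bigr => k _.
by rewrite mxE scaler_suml; apply: eq_bigr => j _; rewrite scalerA.
Qed.

Lemma mul1mx_frame S : mulmx_frame 1%:M S = S.
Proof.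
apply: eq_from_tnth => i; rewrite tnth_mktuple.
rewrite (bigD1 i) //= mxE eqxx scale1r big1 ?addr0 // => j /negPf ji.
by rewrite mxE eq_sym ji scale0r.
Qed.

Lemma frame_mxK S T : basis_of fullv T -> mulmx_frame (frame_mx S T) T = S.
Proof.
move=> bT; apply: eq_from_tnth => i; rewrite tnth_mktuple.
rewrite [RHS](coord_basis bT (memvf _)); apply: eq_bigr => j _.
by rewrite mxE -tnth_nth.
Qed.

Lemma mulmx_frameK M T : basis_of fullv T -> frame_mx (mulmx_frame M T) T = M.
Proof.
move=> bT; apply/matrixP => i j; rewrite mxE tnth_mktuple.
under eq_bigr => k _ do rewrite (tnth_nth 0).
exact: (coord_sum_free (M i) j (basis_free bT)).
Qed.

Lemma frame_mx_unit S T :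
  basis_of fullv S -> basis_of fullv T -> frame_mx S T \in unitmx.
Proof.
move=> bS bT; suff /mulmx1_unit[] : frame_mx S T *m frame_mx T S = 1%:M by [].
(* A matrix is determined by its action on the basis [S], and passing from [S] to [T] and back
   restores [S]. *)
by rewrite -[LHS](mulmx_frameK _ bS) -mulmx_frameA !frame_mxK //
           -{1}[S]mul1mx_frame mulmx_frameK.
Qed.

Lemma map_mulmx_frame (f : 'End(V)) M S :
  map_tuple f (mulmx_frame M S) = mulmx_frame M (map_tuple f S).
Proof.
apply: eq_from_tnth => i; rewrite tnth_map !tnth_mktuple linear_sum.
by apply: eq_bigr => j _; rewrite linearZ tnth_map.
Qed.

Lemma endo_eq_on_basis (f g : 'End(V)) S :
  basis_of fullv S -> map_tuple f S = map_tuple g S -> f =1 g.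
Proof.
move=> bS fg v; rewrite (coord_basis bS (memvf v)) !linear_sum.
apply: eq_bigr => i _; rewrite !linearZ -tnth_nth; congr (_ *: _).
by have := congr1 (fun t => tnth t i) fg; rewrite !tnth_map.
Qed.

Lemma endo_of_frame_mx M S : basis_of fullv S ->
  exists f : 'End(V), map_tuple f S = mulmx_frame M S.
Proof.
move=> /basis_free freeS; have [f fP] := linear_of_free S (mulmx_frame M S).
exists (linfun f); apply: val_inj => /=.
rewrite -(fP freeS) ?size_tuple //.
by apply: eq_map => v; rewrite lfunE.
Qed.

(** With B = [frame_mx S T] one has S = B T, hence T = B^-1 S. As f commutes with matrices acting on
    columns of vectors, f T = B^-1 M S = B^-1 M B T. *)
Lemma frame_mx_endo_change (f : 'End(V)) M S T :
  basis_of fullv S -> basis_of fullv T -> map_tuple f S = mulmx_frame M S ->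
  frame_mx (map_tuple f T) T = invmx (frame_mx S T) *m M *m frame_mx S T.
Proof.
move=> bS bT fS; have uB := frame_mx_unit bS bT.
suff {1}-> : T = mulmx_frame (invmx (frame_mx S T)) S.
  rewrite map_mulmx_frame fS mulmx_frameA.
  by rewrite -{2}(frame_mxK S bT) mulmx_frameA mulmx_frameK.
by rewrite -{2}(frame_mxK S bT) mulmx_frameA mulVmx // mul1mx_frame.
Qed.
End FrameChange.

(** * Complex differentiability of matrix functions *)

Section DerivableMatrices.
Variables (K : numFieldType) (z : K).

Lemma derivable_bigsum (I : Type) (r : seq I) (P : pred I) (f : I -> K -> K) :
  (forall i, P i -> derivable (f i) z 1) ->
  derivable (fun w => \sum_(i <- r | P i) f i w) z 1.
Proof.
move=> df; elim: r => [|i r IHr].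
  by under eq_fun do rewrite big_nil; exact: derivable_cst.
under eq_fun do rewrite big_cons.
by case: ifP => // Pi; exact: derivableD (df i Pi) IHr.
Qed.

Lemma derivable_bigprod (I : Type) (r : seq I) (P : pred I) (f : I -> K -> K) :
  (forall i, P i -> derivable (f i) z 1) ->
  derivable (fun w => \prod_(i <- r | P i) f i w) z 1.
Proof.
move=> df; elim: r => [|i r IHr].
  by under eq_fun do rewrite big_nil; exact: derivable_cst.
under eq_fun do rewrite big_cons.
by case: ifP => // Pi; exact: derivableM (df i Pi) IHr.
Qed.

Definition derivable_mx m n (A : K -> 'M[K]_(m, n)) :=
  forall i j, derivable (fun w => A w i j) z 1.

Lemma derivable_mx_cst m n (M : 'M[K]_(m, n)) : derivable_mx (fun=> M).
Proof. by move=> i j; exact: derivable_cst. Qed.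

Lemma derivable_mulmx m n p (A : K -> 'M[K]_(m, n)) (B : K -> 'M[K]_(n, p)) :
  derivable_mx A -> derivable_mx B -> derivable_mx (fun w => A w *m B w).
Proof.
move=> dA dB i j; under eq_fun do rewrite mxE.
by apply: derivable_bigsum => k _; exact: derivableM.
Qed.

Lemma derivable_det m (A : K -> 'M[K]_m) :
  derivable_mx A -> derivable (fun w => \det (A w)) z 1.
Proof.
move=> dA; apply: derivable_bigsum => s _.
apply: derivableM; first exact: derivable_cst.
by apply: derivable_bigprod => i _; exact: dA.
Qed.

(** Cramer's rule writes the inverse through determinants. [invmx] agrees with that formula only at
    invertible matrices, hence the condition on a whole neighborhood of z. *)
Lemma derivable_invmx m (A : K -> 'M[K]_m) :
  derivable_mx A -> (\forall w \near z, A w \in unitmx) ->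
  derivable_mx (fun w => invmx (A w)).
Proof.
move=> dA uA i j.
pose B w := (\det (A w))^-1 * cofactor (A w) j i.
apply: (@near_eq_derivable _ _ _ B).
  by near=> w; rewrite /B /invmx (near uA w) // !mxE.
apply: derivableM.
  apply: derivableV; last exact: derivable_det.
  by rewrite -unitfE; exact: (nbhs_singleton uA).
apply: derivableM; first exact: derivable_cst.
apply: derivable_det => a b.
by under eq_fun do rewrite !mxE; exact: dA.
Unshelve. all: by end_near. Qed.
End DerivableMatrices.

(** * Commutation with the jet matrices, and action on frames *)

Section PascalMatrix.
Variables (R : realType) (l n : nat).
Local Notation P := (pascal_mx R l n).
Local Notation rk := (@tagnat.Rank n.+1 (fun=> l)).

Lemma jet_pascal_comm (A : Cplx R -> 'M[Cplx R]_l) z :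
  jet_mx n A z *m P = P *m jet_mx n A z.
Proof.
rewrite !mul_mxblock; apply: eq_mxblock => p q.
(* When p <= q the subtraction truncates to 0, which is harmless since C(p, q + 1) vanishes. *)
pose D := deriv_mx (p - q.+1) A z.
transitivity ((q.+1 * 'C(p, q.+1))%:R *: D).
  (* Column q of [P] has its only nonzero block in row q + 1. The last column, q = n, has none, in
     accordance with C(p, n + 1) = 0. *)
  have [ltqn|leqn] := ltnP q.+1 n.+1; last first.
    rewrite bin_small ?muln0 ?scale0r ?(leq_trans (ltn_ord p)) //.
    rewrite big1 // => r _; case: eqP => [rq|]; last by rewrite mulmx0.
    by move: (ltn_ord r); rewrite rq ltnNge leqn.
  rewrite (bigD1 (Ordinal ltqn)) //= eqxx big1 => [|r rq]; last first.
    have /negPf-> : r != q.+1 :> nat by [].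
    by rewrite mulmx0.
  rewrite addr0 mul_mx_scalar natrM -scalerA; congr (_ *: _).
  by case: leqP => // ltpq; rewrite bin_small ?scale0r.
(* The coefficient becomes p C(p - 1, q), the one produced by row p of [P], whose only nonzero block
   is in column p - 1; row 0 is zero. *)
rewrite -mul_bin_diag.
have [p0|p_gt0] := posnP p.
  rewrite p0 mul0n scale0r big1 // => r _.
  by rewrite /= mul0mx.
have ltpn : (p.-1 < n.+1)%N := leq_ltn_trans (leq_pred p) (ltn_ord p).
rewrite (bigD1 (Ordinal ltpn)) //= prednK // eqxx big1 => [|r rp]; last first.
  have /negPf-> : p != r.+1 :> nat.
    by apply: contraNneq rp => pr; apply/eqP/val_inj; rewrite /= pr.
  by rewrite mul0mx.
rewrite addr0 mul_scalar_mx natrM -scalerA; congr (_ *: _).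
have -> : D = deriv_mx (p.-1 - q) A z by rewrite /D -{1}(prednK p_gt0) subSS.
by case: leqP => // ltpq; rewrite bin_small ?scale0r.
Qed.

Lemma pascal_mxE (k j : 'I_n.+1) (i a : 'I_l) :
  P (rk k i) (rk j a) = if (k == j.+1 :> nat) && (i == a) then k%:R else 0.
Proof.
pose B (p q : 'I_n.+1) : 'M[Cplx R]_l :=
  if p == q.+1 :> nat then p%:R%:M else 0.
transitivity (B k j i a); first by rewrite -(mxblockK B) !mxE.
by rewrite /B; case: eqP => _; rewrite !mxE // mulrb.
Qed.

Variable V : vectType (Cplx R).
Variable S : (\sum_(p < n.+1) l).-tuple V.

Lemma tnth_pascal0 i : tnth (mulmx_frame P S) (rk ord0 i) = 0.
Proof.
rewrite tnth_mktuple big1 // => s _.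
by rewrite -(tagnat.sig2K s) pascal_mxE scale0r.
Qed.

Lemma tnth_pascalS (k j : 'I_n.+1) i : k = j.+1 :> nat ->
  tnth (mulmx_frame P S) (rk k i) = k%:R *: tnth S (rk j i).
Proof.
move=> kj; rewrite tnth_mktuple (bigD1 (rk j i)) //= pascal_mxE kj !eqxx /=.
(* Each index [s] is the [Rank] of its block and of its position there, so a nonzero entry would
   force [s] to be [rk j i]. *)
rewrite [X in _ + X]big1 ?addr0 // => s; rewrite -(tagnat.sig2K s) => ne.
rewrite pascal_mxE kj eqSS; case: ifP => [/andP[/eqP/val_inj jE /eqP iE]|].
  by case/eqP: ne; rewrite iE; move: (tagnat.sig2 s); rewrite -jE.
by rewrite scale0r.
Qed.
End PascalMatrix.

(** * Construction of the Pascal map *)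

Section PascalMap.
Variables (R : realType) (Omega : set (Cplx R)) (l n : nat).
Variables (E : hol_vbundle Omega l) (En : jet_bundle E n).
Local Notation P := (pascal_mx R l n).

(** Provides an induced frame of E^n around every point of Omega. *)
Definition triv_hol_frame (a : triv_index E) : hol_frame E (triv_dom E a) :=
  HolFrame (@triv_dom_open _ _ _ E a) (@triv_dom_sub _ _ _ E a)
    (@triv_frame_basis _ _ _ E a) (@triv_transition_hol _ _ _ E a).

(** Quantifying over all frames around z makes the later choice of an endomorphism independent of
    any trivialization. *)
Definition pascal_rule z (f : 'End(En z)) :=
  forall U (s : hol_frame E U), U z ->
    map_tuple f (jet_frame En s z) = mulmx_frame P (jet_frame En s z).

Lemma pascal_rule_frame_indep a z (f : 'End(En z)) : triv_dom E a z ->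
  map_tuple f (jet_frame En (triv_hol_frame a) z) =
    mulmx_frame P (jet_frame En (triv_hol_frame a) z) ->
  pascal_rule f.
Proof.
move=> az fa U s Uz.
pose A w := frame_mx (s w) (triv_frame E a w).
have -> : jet_frame En s z =
    mulmx_frame (jet_mx n A z) (jet_frame En (triv_hol_frame a) z).
  apply: jet_frame_change => //.
  - exact: frame_hol.
  - by move=> w [Uw aw]; apply: frame_mx_unit;
      [exact: frame_basis|exact: triv_frame_basis].
  - by move=> w [Uw aw]; rewrite frame_mxK //; exact: triv_frame_basis.
(* With T the jet frame of the trivialization and L the jet matrix of [A], f (L T) = L (f T) = L P T
   = P L T. *)
by rewrite map_mulmx_frame fa !mulmx_frameA jet_pascal_comm.
Qed.

(** The condition [Omega z] sits under the existential so that choice yields an endomorphism at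
    every point of the plane, as a bundle map requires; outside Omega the zero map serves. *)
Lemma pascal_rule_exists z : exists f : 'End(En z), Omega z -> pascal_rule f.
Proof.
have [Oz|nOz] := pselect (Omega z); last by exists 0.
have [a az] := triv_dom_cover E Oz.
have [f fP] :=
  endo_of_frame_mx P (frame_basis (jet_frame En (triv_hol_frame a)) az).
by exists f => _; exact: pascal_rule_frame_indep fP.
Qed.

Definition pascal_endo z : 'End(En z) := projT1 (cid (pascal_rule_exists z)).

Lemma pascal_endoP z : Omega z -> pascal_rule (pascal_endo z).
Proof. exact: projT2 (cid (pascal_rule_exists z)). Qed.

Lemma pascal_endo_hol b :
  holomorphic_mx (triv_dom En b)
    (fun z => frame_mx (map_tuple (pascal_endo z) (triv_frame En b z))
                       (triv_frame En b z)).
Proof.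
move=> i j z bz.
have [a az] := triv_dom_cover E (triv_dom_sub bz).
pose t := jet_frame En (triv_hol_frame a).
pose B w := frame_mx (t w) (triv_frame En b w).
pose W := triv_dom E a `&` triv_dom En b.
have nearW : \forall w \near z, W w.
  apply: open_nbhs_nbhs; split=> //.
  by apply: openI; exact: triv_dom_open.
have hB : derivable_mx z B by move=> p q; exact: (@frame_hol _ _ _ _ _ t b p q z (conj az bz)).
have uB : \forall w \near z, B w \in unitmx.
  apply: filterS nearW => w [aw bw].
  by apply: frame_mx_unit; [exact: frame_basis|exact: triv_frame_basis].
(* The endomorphisms were chosen point by point, yet all of those near z have matrix [P] in the
   single holomorphic frame [t], which gives this formula on the whole of [W]. *)
apply: (@near_eq_derivable _ _ _ (fun w => (invmx (B w) *m P *m B w) i j)).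
  apply: filterS nearW => w [aw bw].
  rewrite -(frame_mx_endo_change (f := pascal_endo w)) //.
  - exact: frame_basis.
  - exact: triv_frame_basis.
  - by apply: pascal_endoP => //; exact: triv_dom_sub aw.
exact: (derivable_mulmx
  (derivable_mulmx (derivable_invmx hB uB) (@derivable_mx_cst _ z _ _ P)) hB).
Qed.

Definition pascal_map : bundle_endo En := BundleEndo pascal_endo_hol.
End PascalMap.

Theorem theorem3p2 (R : realType) (Omega : set (Cplx R)) (l n : nat)
    (E : hol_vbundle Omega l) (En : jet_bundle E n) :
  is_domain Omega -> (0 < n)%N ->
  exists Phi : bundle_endo En,
    [/\ forall (U : set (Cplx R)) (s : hol_frame E U),
          represented_by U Phi (jet_frame En s) (pascal_mx R l n),
        forall (U : set (Cplx R)) (s : hol_frame E U) (i : 'I_l) (z : Cplx R),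
          U z ->
          Phi z (jet_section En s ord0 i z) = 0 /\
          forall k j : 'I_n.+1, k = j.+1 :> nat ->
            Phi z (jet_section En s k i z) = k%:R *: jet_section En s j i z &
        forall Psi : bundle_endo En,
          (forall (U : set (Cplx R)) (s : hol_frame E U),
             represented_by U Psi (jet_frame En s) (pascal_mx R l n)) ->
          forall z, Omega z -> forall v : En z, Psi z v = Phi z v].
Proof.
move=> _ _; exists (pascal_map En).
have PhiP U (s : hol_frame E U) :
    represented_by U (pascal_map En) (jet_frame En s) (pascal_mx R l n).
  by move=> z Uz; apply: pascal_endoP => //; exact: (frame_dom_sub s).
split=> // [U s i z Uz|Psi PsiP z Oz].
  have PhiE r : pascal_map En z (tnth (jet_frame En s z) r) =
      tnth (mulmx_frame (pascal_mx R l n) (jet_frame En s z)) r.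
    by rewrite -(PhiP U s z Uz) tnth_map.
  by split=> [|k j kj]; rewrite /jet_section PhiE;
    [exact: tnth_pascal0|exact: tnth_pascalS].
(* Uniqueness: both maps have matrix [P] in one induced frame at z, which is a basis of the
   fiber. *)
have [a az] := triv_dom_cover E Oz.
apply: (endo_eq_on_basis (frame_basis (jet_frame En (triv_hol_frame a)) az)).
by rewrite PsiP // PhiP.
Qed.
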